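(* Let $m\geq2$ and $z=x/(1-t)$. Then (a) \[ \sum_{n=0}^{\infty}\frac{A_{12\cdots m,n}^{\mathrm{ides}}(s,t)}{(1-t)^{n+1}}x^{n}=\sum_{n=0}^{\infty}\Bigg(\frac{tx}{(1-t)^{2}}+\frac{(s-1)tz^{m}}{(1-t)(1-(s-1)\sum_{l=1}^{m-1}z^{l})}\Bigg)^{*\langle n\rangle}, \] (b) \[ \sum_{n=0}^{\infty}\frac{A_{12\cdots m,n}^{\mathrm{ides}}(t)}{(1-t)^{n+1}}x^{n}=\sum_{n=0}^{\infty}\Bigg(\frac{tz(1-z^{m-1})}{(1-t)(1-z^{m})}\Bigg)^{*\langle n\rangle}, \] and (c) \[ \sum_{n=0}^{\infty}\frac{A_{12\cdots m,n}^{\mathrm{ides}}(t)}{(1-t)^{n+1}}x^{n}=1+\sum_{k=1}^{\infty}\left[\sum_{j=0}^{\infty}\left({k+jm-1 \choose k-1}x^{jm}-{k+jm \choose k-1}x^{jm+1}\right)\right]^{-1}t^{k}. \]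
   Context: $\mathfrak{S}_n$ is the set of permutations of $[n]$ in one-line notation. $\operatorname{std}$ of a sequence of distinct integers replaces its letters by $1,2,\dots$ in order of size. For $\pi\in\mathfrak{S}_n$ and $\sigma\in\mathfrak{S}_m$, $\operatorname{occ}_\sigma(\pi)$ is the number of $i\in[n-m+1]$ with $\operatorname{std}(\pi_i\cdots\pi_{i+m-1})=\sigma$. $\operatorname{des}(\pi)$ is the number of $i\in[n-1]$ with $\pi_i>\pi_{i+1}$ and $\operatorname{ides}(\pi)=\operatorname{des}(\pi^{-1})$. $A_{\sigma,n}^{\mathrm{ides}}(s,t)=\sum_{\pi\in\mathfrak{S}_n}s^{\operatorname{occ}_\sigma(\pi)}t^{\operatorname{ides}(\pi)+1}$ for $n\ge1$, $=1$ for $n=0$, and $A_{\sigma,n}^{\mathrm{ides}}(t)=A_{\sigma,n}^{\mathrm{ides}}(0,t)$. In (a),(b) the right sides are computed in formal power series with ordinary multiplication in $s,x$ and the Hadamard product in $t$: $(\sum_n a_nt^n)*(\sum_n b_nt^n)=\sum_n a_nb_nt^n$; $f^{*\langle n\rangle}$ is the $n$-fold Hadamard product, $f^{*\langle0\rangle}=1/(1-t)$. In (c), $[\cdot]^{-1}$ is the ordinary inverse in $\mathbb{Q}[[x]]$. Other expressions use ordinary multiplication. *)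

(* Defs.v *)
From HB Require Import structures.
From mathcomp Require Import all_boot all_order all_algebra all_fingroup.
From mathcomp Require Import boolp.
Set Implicit Arguments.
Unset Strict Implicit.
Unset Printing Implicit Defensive.
Import GRing.Theory.
Local Open Scope ring_scope.

(** * Formal power series *)

(* [f n] is the coefficient of the n-th power of the variable. Multivariate
   series are iterated: in [{fps {fps K}}] the outer variable is t, the inner
   one is x, so that [f n] is the coefficient of t^n, an element of K[[x]]. *)
Record fps (R : Type) := Fps { fps_coef :> nat -> R }.
Arguments Fps {R}.

Notation "{ 'fps' R }" := (fps R) (at level 0, format "{ 'fps'  R }").

Lemma fpsP (R : Type) (f g : {fps R}) : (forall n, f n = g n) -> f = g.
Proof. by case: f g => [f] [g] /= fg; congr Fps; apply/funext. Qed.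

HB.instance Definition _ (R : Type) := gen_eqMixin {fps R}.
HB.instance Definition _ (R : Type) := gen_choiceMixin {fps R}.

Section FpsZmodule.
Variable R : zmodType.
Implicit Types f g h : {fps R}.

Definition fps_zero : {fps R} := Fps (fun=> 0).
Definition fps_opp f := Fps (fun n => - f n).
Definition fps_add f g := Fps (fun n => f n + g n).

Fact fps_addA : associative fps_add.
Proof. by move=> f g h; apply: fpsP => n; exact: addrA. Qed.
Fact fps_addC : commutative fps_add.
Proof. by move=> f g; apply: fpsP => n; exact: addrC. Qed.
Fact fps_add0 : left_id fps_zero fps_add.
Proof. by move=> f; apply: fpsP => n; exact: add0r. Qed.
Fact fps_addN : left_inverse fps_zero fps_opp fps_add.
Proof. by move=> f; apply: fpsP => n; exact: addNr. Qed.

HB.instance Definition _ :=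
  GRing.isZmodule.Build {fps R} fps_addA fps_addC fps_add0 fps_addN.

Lemma coef_fps0 n : (0 : {fps R}) n = 0. Proof. by []. Qed.
Lemma coef_fpsN f n : (- f) n = - f n. Proof. by []. Qed.
Lemma coef_fpsD f g n : (f + g) n = f n + g n. Proof. by []. Qed.
Lemma coef_fpsB f g n : (f - g) n = f n - g n. Proof. by []. Qed.
Lemma coef_fps_sum I (r : seq I) (P : pred I) (F : I -> {fps R}) n :
  (\sum_(i <- r | P i) F i) n = \sum_(i <- r | P i) F i n.
Proof. by elim/big_rec2: _ => // i y f _ <-. Qed.

End FpsZmodule.

Section FpsRing.
Variable R : comNzRingType.
Implicit Types f g h : {fps R}.

Definition fpsC (c : R) : {fps R} := Fps (fun n => if n is 0 then c else 0).
Definition fpsX : {fps R} := Fps (fun n => (n == 1%N)%:R).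
Definition fps_mul f g :=
  Fps (fun n => \sum_(i < n.+1) f i * g (n - i)%N).

Let tr N f : {poly R} := \poly_(i < N) f i.

Let tr_coef N f n : (n < N)%N -> (tr N f)`_n = f n.
Proof. by move=> nN; rewrite coef_poly nN. Qed.

Let tr_mul N f g n : (n < N)%N -> (tr N f * tr N g)`_n = fps_mul f g n.
Proof.
move=> nN; rewrite coefM; apply: eq_bigr => i _; rewrite !tr_coef //.
  exact: leq_ltn_trans (leq_subr _ _) nN.
by apply: leq_ltn_trans nN; rewrite -ltnS.
Qed.

Fact fps_mulC : commutative fps_mul.
Proof. by move=> f g; apply: fpsP => n; rewrite -!(@tr_mul n.+1) // mulrC. Qed.

Fact fps_mulA : associative fps_mul.
Proof.
move=> f g h; apply: fpsP => n.
have -> : fps_mul f (fps_mul g h) n =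
    (tr n.+1 f * (tr n.+1 g * tr n.+1 h))`_n.
  rewrite coefM; apply: eq_bigr => i _.
  by rewrite tr_coef // tr_mul // ltnS leq_subr.
rewrite mulrA coefM; apply: eq_bigr => i _.
by rewrite tr_mul // tr_coef // ltnS leq_subr.
Qed.

Fact fps_mul1 : left_id (fpsC 1) fps_mul.
Proof.
move=> f; apply: fpsP => n; rewrite /= big_ord_recl /= mul1r subn0 big1 ?addr0//.
by move=> i _; rewrite mul0r.
Qed.

Fact fps_mulDl : left_distributive fps_mul (@fps_add R).
Proof.
move=> f g h; apply: fpsP => n /=; rewrite -big_split /=.
by apply: eq_bigr => i _; rewrite mulrDl.
Qed.

Fact fps_1neq0 : fpsC 1 != 0.
Proof.
by apply/eqP => /(congr1 (fun f : {fps R} => f 0%N)) /eqP; rewrite oner_eq0.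
Qed.

HB.instance Definition _ := GRing.Zmodule_isComNzRing.Build {fps R}
  fps_mulA fps_mulC fps_mul1 fps_mulDl fps_1neq0.

Lemma coef_fps1 n : (1 : {fps R}) n = (n == 0%N)%:R. Proof. by case: n. Qed.
Lemma coef_fpsM f g n : (f * g) n = \sum_(i < n.+1) f i * g (n - i)%N.
Proof. by []. Qed.

End FpsRing.

Arguments fpsX {R}.

Section FpsUnit.
Variable R : comUnitRingType.
Implicit Types f g : {fps R}.

(* The first n coefficients of the inverse of f. *)
Fixpoint fps_inv_seq f (n : nat) : seq R :=
  if n is n'.+1 then
    let s := fps_inv_seq f n' in
    rcons s ((f 0%N)^-1 *
      ((n' == 0%N)%:R - \sum_(i < n') f i.+1 * s`_(n' - i.+1)))
  else [::].

Definition fps_unit : {pred {fps R}} := fun f => f 0%N \is a GRing.unit.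
Definition fps_inv f : {fps R} :=
  if fps_unit f then Fps (fun n => (fps_inv_seq f n.+1)`_n) else f.

Let size_inv f n : size (fps_inv_seq f n) = n.
Proof. by elim: n => //= n IHn; rewrite size_rcons IHn. Qed.

Let nth_inv f n k : (k < n)%N -> (fps_inv_seq f n)`_k = (fps_inv_seq f k.+1)`_k.
Proof.
elim: n => // n IHn; rewrite ltnS leq_eqVlt => /predU1P[-> //|kn].
by rewrite [fps_inv_seq f n.+1]/= nth_rcons size_inv kn IHn.
Qed.

Fact fps_mulVx : {in fps_unit, left_inverse 1 fps_inv *%R}.
Proof.
move=> f uf; have u0 : f 0%N \is a GRing.unit := uf.
rewrite mulrC /fps_inv; have -> : fps_unit f = true := uf.
apply: fpsP => n; rewrite coef_fpsM coef_fps1 big_ord_recl subn0.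
rewrite [Fps _ n]/= nth_rcons size_inv ltnn eqxx mulrA divrr // mul1r.
rewrite -[RHS]addr0 -addrA; congr (_ + _); apply/eqP.
rewrite addrC subr_eq0; apply/eqP/eq_bigr => i _; rewrite lift0.
congr (_ * _); apply/esym/nth_inv.
by rewrite -subSn // subSS leq_subr.
Qed.

Fact fps_unitPl f g : g * f = 1 -> fps_unit f.
Proof.
move=> /(congr1 (fun h : {fps R} => h 0%N)); rewrite coef_fpsM big_ord1 /= => gf.
by apply/unitrPr; exists (g 0%N); rewrite mulrC.
Qed.

Fact fps_inv_out : {in [predC fps_unit], fps_inv =1 id}.
Proof.
by move=> f /negPf uf; rewrite /fps_inv; have -> : fps_unit f = false := uf.
Qed.

HB.instance Definition _ := GRing.ComNzRing_hasMulInverse.Build {fps R}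
  fps_mulVx fps_unitPl fps_inv_out.

Lemma fps_unitE f : (f \is a GRing.unit) = (f 0%N \is a GRing.unit).
Proof. by []. Qed.

End FpsUnit.

(* Convergence of infinite sums is coefficientwise: every coefficient of the
   partial sums is eventually constant. [fps2_has_sum] looks at the coefficients
   of all monomials t^i x^j. *)
Definition fps_has_sum (K : zmodType) (F : nat -> {fps K}) (S : {fps K}) :=
  forall i, exists N, forall n, (N <= n)%N -> (\sum_(k < n) F k) i = S i.

Definition fps2_has_sum (K : zmodType) (F : nat -> {fps {fps K}})
    (S : {fps {fps K}}) :=
  forall i j, exists N, forall n, (N <= n)%N -> (\sum_(k < n) F k) i j = S i j.

Definition hadamard (R : pzRingType) (f g : {fps R}) : {fps R} :=
  Fps (fun n => f n * g n).

Definition hadamard_pow (R : comUnitRingType) (f : {fps R}) (n : nat) : {fps R} :=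
  iter n (hadamard f) (1 - fpsX)^-1.

Definition tvar (K : comNzRingType) : {fps {fps K}} := fpsX.
Definition xvar (K : comNzRingType) : {fps {fps K}} := fpsC fpsX.
Definition zvar (K : comUnitRingType) : {fps {fps K}} := xvar K / (1 - tvar K).
Definition svar (K : comNzRingType) : {fps {fps {fps K}}} := fpsC (fpsC fpsX).

(** * Permutation statistics *)

Definition oneline (n : nat) (pi : 'S_n) : seq nat :=
  [seq (pi i).+1 | i <- enum 'I_n].

Definition std (w : seq nat) : seq nat :=
  [seq count (fun b => b <= a)%N w | a <- w].

(* Here [n.+1 - m] is n - m + 1 when m <= n, and 0 when n < m. *)
Definition occ (m n : nat) (sigma : 'S_m) (pi : 'S_n) : nat :=
  count (fun i => std (take m (drop i (oneline pi))) == oneline sigma)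
    (iota 0 (n.+1 - m)).

Definition des (n : nat) (pi : 'S_n) : nat :=
  count (fun i => nth 0 (oneline pi) i > nth 0 (oneline pi) i.+1)%N
    (iota 0 n.-1).

Definition ides (n : nat) (pi : 'S_n) : nat := des (pi^-1)%g.

(* The polynomial A_{sigma,n}^{ides}, evaluated at elements s, t of a ring. *)
Definition A_ides (R : comNzRingType) (m : nat) (sigma : 'S_m) (n : nat)
    (s t : R) : R :=
  if n == 0%N then 1
  else \sum_(pi : 'S_n) s ^+ occ sigma pi * t ^+ (ides pi).+1.

(* The identity permutation, i.e., 12...m in one-line notation. *)
Definition incr_perm (m : nat) : 'S_m := 1%g.

(* Main.v *)
Require Import Defs.
From mathcomp Require Import all_boot all_order all_algebra all_fingroup.
From mathcomp Require Import zify ring.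
From HB Require Import structures.
Set Implicit Arguments.
Unset Strict Implicit.
Unset Printing Implicit Defensive.
Import GRing.Theory.
Local Open Scope ring_scope.

(* Compare coefficients of t^k. A word over [k] of length n standardizes to a
   permutation pi, and C(n+k-1-ides(pi), n) = [t^k] t^(ides(pi)+1)/(1-t)^(n+1)
   words standardize to pi. Standardization turns occurrences of 12...m into
   weakly increasing factors of length m, so the left-hand side of (a) has t^k
   coefficient the sum of s^(number of such factors) x^(length) over all words.
   Cut a word at the end of its first maximal weakly increasing run: a run of
   length L contributes s^max(0, L+1-m), and if c(u) is the inverse of the
   series of these weights, then the sum over all weakly increasing prefixes of
   c_L times the weight of the rest vanishes on every nonempty word. Hence the word series is
   the inverse of sum_L c_L C(L+k-1, L) x^L, which is one minus the t^k
   coefficient of (t/(1-t)) (1 - c(z)), the series whose Hadamard powers are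
   summed in (a). Parts (b) and (c) are the case s = 0, where
   c(u) = (1-u)/(1-u^m). *)

(** * Formal power series *)

Section FpsCoef.
Variable R : comNzRingType.
Implicit Types (c : R) (f g : {fps R}).

Fact fpsC_is_zmod_morphism : zmod_morphism (@fpsC R).
Proof. by move=> a b; apply: fpsP => -[|n] //; rewrite coef_fpsB subr0. Qed.

Fact fpsC_is_monoid_morphism : monoid_morphism (@fpsC R).
Proof.
split=> // a b; apply: fpsP => -[|n]; first by rewrite coef_fpsM big_ord1.
by rewrite coef_fpsM big_ord_recl big1 ?mulr0 ?addr0 // => i _; rewrite mul0r.
Qed.

HB.instance Definition _ :=
  GRing.isZmodMorphism.Build R {fps R} (@fpsC R) fpsC_is_zmod_morphism.
HB.instance Definition _ :=
  GRing.isMonoidMorphism.Build R {fps R} (@fpsC R) fpsC_is_monoid_morphism.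

Lemma coef_fpsCM c f n : (fpsC c * f) n = c * f n.
Proof.
rewrite coef_fpsM big_ord_recl subn0 big1 ?addr0 // => i _.
by rewrite mul0r.
Qed.

Lemma coef_fpsXM f n : (fpsX * f) n = if n is n'.+1 then f n' else 0.
Proof.
case: n => [|n]; first by rewrite coef_fpsM big_ord1 mul0r.
rewrite coef_fpsM !big_ord_recl /= mul0r add0r mul1r subSS subn0.
by rewrite big1 ?addr0 // => i _; rewrite mul0r.
Qed.

Lemma coef_fpsXnM d f n : (fpsX ^+ d * f) n = if (d <= n)%N then f (n - d)%N else 0.
Proof.
elim: d n => [|d IHd] n; first by rewrite mul1r subn0.
by rewrite exprS -mulrA coef_fpsXM; case: n => //= n; rewrite IHd subSS.
Qed.

Lemma coef_fpsXn d n : (fpsX ^+ d : {fps R}) n = (n == d)%:R.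
Proof.
rewrite -[fpsX ^+ d]mulr1 coef_fpsXnM coef_fps1.
by case: leqP => dn; [rewrite subn_eq0 eqn_leq dn andbT | rewrite ltn_eqF].
Qed.

(** Each factor f without constant term raises the order by at least one. *)
Lemma coef_fps_expM_eq0 N f g n : f 0%N = 0 -> (n < N)%N -> (f ^+ N * g) n = 0.
Proof.
move=> f0; elim: N n => // N IHN n nN; rewrite exprS -mulrA coef_fpsM.
rewrite big_ord_recl f0 mul0r add0r big1 // => i _.
by rewrite IHN ?mulr0 // lift0; have := ltn_ord i; lia.
Qed.

End FpsCoef.

Section FpsInverse.
Variable R : comUnitRingType.
Implicit Types f g : {fps R}.

Lemma fps_unit_1B f : f 0%N = 0 -> 1 - f \is a GRing.unit.
Proof. by move=> f0; rewrite fps_unitE coef_fpsB f0 subr0 unitr1. Qed.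

(** The partial sum differs from the inverse by f^N / (1 - f), which has no term below degree N. *)
Lemma coef_fps_geom N f n : f 0%N = 0 -> (n < N)%N ->
  (\sum_(i < N) f ^+ i) n = (1 - f)^-1 n.
Proof.
move=> f0 nN; have u := fps_unit_1B f0.
have -> : \sum_(i < N) f ^+ i = (1 - f)^-1 - f ^+ N * (1 - f)^-1.
  apply: (mulrI u); rewrite mulrBr mulrCA divrr // mulr1.
  by rewrite -opprB mulNr -subrX1 opprB.
by rewrite coef_fpsB coef_fps_expM_eq0 // subr0.
Qed.

(** Multiplying by 1 - X takes differences of consecutive coefficients, so Pascal's rule gives the
    induction step. *)
Lemma coef_fps_expV1BX n j : ((1 - fpsX : {fps R}) ^- n.+1) j = 'C(n + j, n)%:R.
Proof.
have u : (1 - fpsX : {fps R}) \is a GRing.unit by exact: fps_unit_1B.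
suff -> : (1 - fpsX : {fps R}) ^- n.+1 = Fps (fun j => 'C(n + j, n)%:R) by [].
elim: n => [|n IHn]; apply: (mulrI u); apply: fpsP.
  rewrite divrr // mulrBl mul1r => k; rewrite coef_fpsB coef_fpsXM coef_fps1.
  by case: k => [|k]; rewrite /= !bin0 ?subr0 ?subrr.
rewrite exprSr invrM ?unitrX // mulVKr // IHn.
rewrite mulrBl mul1r => k; rewrite coef_fpsB coef_fpsXM.
case: k => [|k] /=; first by rewrite subr0 !addn0 !binn.
by rewrite (addSnnS n k) addSn binS natrD addrAC subrr add0r.
Qed.

End FpsInverse.

(** * Exchange of t and x, and the substitution u = z *)

Section Transpose.
Variable K : comNzRingType.

Definition fps_swap (f : {fps {fps K}}) : {fps {fps K}} :=
  Fps (fun i => Fps (fun j => f j i)).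

Fact fps_swap_is_zmod_morphism : zmod_morphism fps_swap.
Proof. by move=> f g; apply: fpsP => i; apply: fpsP => j. Qed.

Fact fps_swap_is_monoid_morphism : monoid_morphism fps_swap.
Proof.
split=> [|f g]; apply: fpsP => i; apply: fpsP => j; first by case: i j => [|i] [|j].
rewrite -[LHS]/((f * g) j i) !(coef_fpsM, coef_fps_sum) /=.
exact: exchange_big.
Qed.

HB.instance Definition _ :=
  GRing.isZmodMorphism.Build _ _ fps_swap fps_swap_is_zmod_morphism.
HB.instance Definition _ :=
  GRing.isMonoidMorphism.Build _ _ fps_swap fps_swap_is_monoid_morphism.

Lemma fps_swapK : involutive fps_swap.
Proof. by move=> f; apply: fpsP => i; apply: fpsP => j. Qed.

Lemma fps_swap_tvar : fps_swap (tvar K) = xvar K.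
Proof.
apply: fpsP => i; apply: fpsP => j /=.
by case: i => [|i]; case: j => [|[|j]].
Qed.

Lemma fps_swap_xvar : fps_swap (xvar K) = tvar K.
Proof. by rewrite -fps_swap_tvar fps_swapK. Qed.

Variable y : {fps K}.

(** The substitution of X y for u in c(u), where X is the outer variable; each coefficient is a
    single term, so no limit is taken. *)
Definition fps_dilate (c : {fps K}) : {fps {fps K}} :=
  Fps (fun n => fpsC (c n) * y ^+ n).

Fact fps_dilate_is_zmod_morphism : zmod_morphism fps_dilate.
Proof.
by move=> f g; apply: fpsP => i; rewrite [LHS]/= coef_fpsB rmorphB mulrBl.
Qed.

Fact fps_dilate_is_monoid_morphism : monoid_morphism fps_dilate.
Proof.
split=> [|f g]; apply: fpsP => n.
  rewrite [LHS]/= !coef_fps1; case: n => [|n]; first by rewrite mulr1 rmorph1.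
  by rewrite rmorph0 mul0r.
rewrite [LHS]/= !coef_fpsM rmorph_sum mulr_suml; apply: eq_bigr => i _ /=.
have -> : y ^+ n = y ^+ i * y ^+ (n - i) by rewrite -exprD subnKC // -ltnS.
by rewrite rmorphM mulrACA.
Qed.

HB.instance Definition _ :=
  GRing.isZmodMorphism.Build _ _ fps_dilate fps_dilate_is_zmod_morphism.
HB.instance Definition _ :=
  GRing.isMonoidMorphism.Build _ _ fps_dilate fps_dilate_is_monoid_morphism.

Lemma fps_dilateC a : fps_dilate (fpsC a) = fpsC (fpsC a).
Proof.
by apply: fpsP => -[|n] /=; rewrite ?mulr1 // rmorph0 mul0r.
Qed.

Lemma fps_dilateX : fps_dilate fpsX = tvar K * fpsC y.
Proof.
apply: fpsP => n; rewrite coef_fpsXM.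
by case: n => [|[|n]] /=; rewrite ?rmorph0 ?rmorph1 ?mul0r ?mul1r ?expr1.
Qed.

End Transpose.

Section SubstZ.
Variable K : comUnitRingType.

(* c(u) |-> c(z), computed in the transposed ring, where (1-t)^-1 is a constant. *)
Definition substz : {fps K} -> {fps {fps K}} :=
  @fps_swap K \o fps_dilate (1 - fpsX)^-1.

HB.instance Definition _ := GRing.RMorphism.on substz.

Lemma tvar_unit : 1 - tvar K \is a GRing.unit.
Proof. exact: fps_unit_1B. Qed.

Lemma fps_swap_fpsC1BXV :
  fps_swap (fpsC (1 - fpsX : {fps K})^-1) = (1 - tvar K)^-1.
Proof.
apply: (mulrI tvar_unit); rewrite divrr ?tvar_unit // -fps_swap_xvar.
rewrite -[1 in LHS](rmorph1 (@fps_swap K)) -rmorphB -rmorphM /=.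
rewrite /xvar -[1 in LHS](rmorph1 (@fpsC _)) -rmorphB -rmorphM /=.
by rewrite divrr ?rmorph1 // fps_unit_1B.
Qed.

Lemma substzC a : substz (fpsC a) = fpsC (fpsC a).
Proof.
rewrite /substz /= fps_dilateC; apply: fpsP => i; apply: fpsP => j /=.
by case: i j => [|i] [|j].
Qed.

Lemma substzX : substz fpsX = zvar K.
Proof.
by rewrite /substz /= fps_dilateX rmorphM /= fps_swap_tvar fps_swap_fpsC1BXV.
Qed.

(** Termwise, t/(1-t) z^n = x^n t/(1-t)^(n+1), and the t^k coefficient of t/(1-t)^(n+1) is C(n+k-1,
    n) for k > 0. *)
Lemma coef_tvarM_substz (c : {fps K}) k n :
  (tvar K / (1 - tvar K) * substz c) k n =
  if k is k'.+1 then c n * 'C(n + k', n)%:R else 0.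
Proof.
have -> : tvar K / (1 - tvar K) * substz c =
    fps_swap (fpsC (fpsX / (1 - fpsX)) * fps_dilate (1 - fpsX)^-1 c).
  by rewrite !rmorphM /= fps_swap_fpsC1BXV fps_swap_xvar.
rewrite -[LHS]/((fpsC _ * fps_dilate _ c) n k) coef_fpsCM.
rewrite mulrCA coef_fpsCM -mulrA -exprS.
rewrite coef_fpsXM; case: k => [|k]; first by rewrite mulr0.
by rewrite exprVn coef_fps_expV1BX.
Qed.

End SubstZ.

(** * Sums over words and their runs *)

Section TupleSum.
Variables (R : nmodType) (T : finType).
Implicit Type F : seq T -> R.

Lemma big_tuple0 F : \sum_(w : 0.-tuple T) F w = F [::].
Proof.
rewrite (bigD1 [tuple]) //= big1 ?addr0 // => w.
by move/eqP; case; rewrite tuple0.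
Qed.

Lemma big_tuple_cons n F :
  \sum_(w : n.+1.-tuple T) F w = \sum_(x : T) \sum_(w : n.-tuple T) F (x :: w).
Proof.
rewrite pair_bigA /=.
rewrite (reindex (fun p : T * n.-tuple T => [tuple of p.1 :: p.2])) //=.
exists (fun w => (thead w, [tuple of behead w])) => [[x w] _|w _] /=.
  by congr pair; apply: val_inj.
by rewrite -tuple_eta.
Qed.

Lemma big_tuple_cat n a F : (a <= n)%N ->
  \sum_(w : n.-tuple T) F w =
  \sum_(u : a.-tuple T) \sum_(v : (n - a).-tuple T) F (u ++ v).
Proof.
move=> /subnKC; move: (n - a)%N => b <-; elim: a F => [|a IHa] F.
  by rewrite (big_tuple0 (fun u => \sum_(v : b.-tuple T) F (u ++ v))).
rewrite (@big_tuple_cons (a + b) F).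
rewrite (big_tuple_cons a (fun u => \sum_(v : b.-tuple T) F (u ++ v))).
by apply: eq_bigr => x _; rewrite (IHa (fun w => F (x :: w))).
Qed.

End TupleSum.

(** The windows range over the same starting positions as in [occ], and there are none when the word
    is shorter than m. *)
Definition facocc (T : Type) (r : rel T) (m : nat) (w : seq T) : nat :=
  count (fun i => sorted r (take m (drop i w))) (iota 0 ((size w).+1 - m)).

Section Runs.
Variables (T : Type) (r : rel T).
Implicit Types (x : T) (u v w : seq T).

(** The end of the word also ends a run, hence [true] on the empty word. *)
Definition breaks x v := if v is y :: _ then ~~ r x y else true.

Lemma run_decomposition x w :
  exists u v, [/\ w = u ++ v, path r x u & breaks (last x u) v].
Proof.
elim: w x => [|y w IHw] x; first by exists [::], [::].
have [xy|nxy] := boolP (r x y); last by exists [::], (y :: w).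
have [u [v [-> pu bv]]] := IHw y.
by exists (y :: u), v; rewrite /= xy.
Qed.

(** A prefix longer than the first run contains the failing step from the last letter of the run to
    the first letter of [v]. *)
Lemma sorted_take_run x u v k : path r x u -> breaks (last x u) v ->
  (k <= size (x :: u ++ v))%N ->
  sorted r (take k (x :: u ++ v)) = (k <= size (x :: u))%N.
Proof.
move=> pu bv; rewrite -cat_cons size_cat => kle; rewrite take_cat.
case: (ltngtP k (size (x :: u))) => [ku|ku|->].
- by have := @take_sorted _ r k (x :: u); apply.
- case: v bv kle => [|y v] bv; first by rewrite addn0 leqNgt ku.
  move=> _; have [k' ->] : exists k', (k - size (x :: u))%N = k'.+1.
    by exists (k - size (x :: u)).-1; lia.
  by rewrite [LHS]/= cat_path /= (negPf bv) andbF.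
- by rewrite subnn take0 cats0 [LHS]/= pu.
Qed.

Variable m : nat.
Hypothesis m_ge2 : (2 <= m)%N.

Lemma facocc_nil : facocc r m [::] = 0%N.
Proof.
rewrite /facocc; have -> // : ((size (@nil T)).+1 - m = 0)%N by rewrite /=; lia.
Qed.

Lemma facocc_cons x w :
  facocc r m (x :: w) =
  (((m <= size (x :: w)) && sorted r (take m (x :: w))) + facocc r m w)%N.
Proof.
rewrite /facocc; case: leqP => /= mw; last first.
  by have [-> ->] : ((size w).+2 - m = 0)%N /\ ((size w).+1 - m = 0)%N by lia.
have -> : ((size w).+2 - m = ((size w).+1 - m).+1)%N by lia.
rewrite [iota 0 _]/= (iotaDl 1 0) [LHS]/= count_map.
by [].
Qed.

(** A sorted window starting in the run must lie inside it. This uses m >= 2: a window of one letter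
    would be sorted without the run contributing L + 1 - m in the truncated sense only. *)
Lemma facocc_run x u v : path r x u -> breaks (last x u) v ->
  facocc r m (x :: u ++ v) = ((size (x :: u)).+1 - m + facocc r m v)%N.
Proof.
have headE x' u' : path r x' u' -> breaks (last x' u') v ->
    ((m <= size (x' :: u' ++ v)) && sorted r (take m (x' :: u' ++ v)) =
    (m <= size (x' :: u')))%N.
  move=> pu bv; case: (leqP m) => [mw|wm]; first exact: sorted_take_run.
  by apply/esym/negbTE; move: wm; rewrite /= size_cat; lia.
elim: u x => [|y u IHu] x pu bv; rewrite facocc_cons headE //.
  rewrite leqNgt m_ge2 [LHS]/=.
  by have -> : ((size [:: x]).+1 - m = 0)%N by rewrite /=; lia.
have /andP[_ pu'] := pu.
rewrite [(y :: u) ++ v]/= IHu //=; lia.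
Qed.

Lemma facocc_drop_run x u v i : path r x u -> breaks (last x u) v ->
  (i <= size (x :: u))%N ->
  facocc r m (drop i (x :: u ++ v)) =
  ((size (x :: u) - i).+1 - m + facocc r m v)%N.
Proof.
move=> pu bv; rewrite leq_eqVlt -cat_cons => /predU1P[->|il].
  rewrite drop_size_cat // subnn.
  by have -> : (1 - m = 0)%N by lia.
rewrite drop_cat il -size_drop.
have: sorted r (drop i (x :: u)) by exact: (@drop_sorted _ r i (x :: u)).
have: last x u = last x (drop i (x :: u)).
  by rewrite -[LHS]/(last x (x :: u)) -{1}(cat_take_drop i (x :: u)) last_cat;
    case: drop (size_drop i (x :: u)) => //= /esym/eqP; rewrite subn_eq0 leqNgt il.
case: drop (size_drop i (x :: u)) => [/esym/eqP|y u' _ E pu'].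
  by rewrite subn_eq0 leqNgt il.
by rewrite cat_cons facocc_run // -[last y u']/(last x (y :: u')) -E.
Qed.

End Runs.

(** * Inversion of the series of weighted words *)

Section RunTheorem.
Variables (K : comNzRingType) (T : finType) (r : rel T) (m : nat) (s : K).
Hypothesis m_ge2 : (2 <= m)%N.
Variable c : {fps K}.
Hypothesis c_inv : c * Fps (fun n => s ^+ (n.+1 - m)) = 1.

(* If l is the length of the first maximal run, the terms with i > l vanish and
   the others add up to a multiple of the l-th coefficient of c * c^-1. *)
Lemma sum_run_prefixes (w : seq T) : (0 < size w)%N ->
  \sum_(i < (size w).+1)
    c i * (sorted r (take i w))%:R * s ^+ facocc r m (drop i w) = 0.
Proof.
case: w => // x w _; have [u [v [-> pu bv]]] := run_decomposition r x w.
rewrite -cat_cons; set l := size (x :: u).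
have lw : (l.+1 <= (size ((x :: u) ++ v)).+1)%N by rewrite size_cat ltnS leq_addr.
rewrite -(big_mkord xpredT (fun i => c i * (sorted r (take i ((x :: u) ++ v)))%:R
  * s ^+ facocc r m (drop i ((x :: u) ++ v)))).
rewrite (big_cat_nat (n := l.+1)) //= [X in _ + X](_ : _ = 0); last first.
  rewrite big_nat; apply: big1 => i /andP[li iw].
  by rewrite (sorted_take_run pu bv) // leqNgt li mulr0 mul0r.
rewrite addr0 big_mkord.
have := congr1 (fun f : {fps K} => s ^+ facocc r m v * f l) c_inv.
rewrite coef_fpsM coef_fps1 /= mulr0 mulr_sumr => E; rewrite -[RHS]E.
apply: eq_bigr => i _; have il : (i <= l)%N by rewrite -ltnS.
rewrite (sorted_take_run pu bv); last first.
  by apply: leq_trans il _; rewrite -cat_cons size_cat leq_addr.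
rewrite il mulr1 mulrCA; congr (_ * _); rewrite mulrC -exprD; congr (_ ^+ _).
by rewrite (facocc_drop_run m_ge2 pu bv).
Qed.

(** The product sums over words cut into a sorted prefix and a remainder. Summing over the cut
    first, every nonempty word cancels by [sum_run_prefixes], and the empty word gives the constant
    coefficient 1. *)
Theorem run_theorem :
  Fps (fun n => c n * \sum_(u : n.-tuple T) (sorted r u)%:R)
  * Fps (fun n => \sum_(w : n.-tuple T) s ^+ facocc r m w) = 1.
Proof.
apply: fpsP => n; rewrite coef_fpsM coef_fps1.
transitivity (\sum_(i < n.+1) \sum_(w : n.-tuple T)
  c i * (sorted r (take i w))%:R * s ^+ facocc r m (drop i w)).
  apply: eq_bigr => i _; have le_in : (i <= n)%N by rewrite -ltnS.
  rewrite (big_tuple_cat (fun w =>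
    c i * (sorted r (take i w))%:R * s ^+ facocc r m (drop i w)) le_in).
  rewrite /= -mulrA big_distrlr mulr_sumr; apply: eq_bigr => u _.
  rewrite mulr_sumr; apply: eq_bigr => v _.
  by rewrite take_size_cat ?drop_size_cat ?size_tuple // mulrA.
rewrite exchange_big /=; case: n => [|n].
  rewrite (big_tuple0 (fun w => \sum_(i < 1) c i * (sorted r (take i w))%:R *
    s ^+ facocc r m (drop i w))) big_ord1 /= facocc_nil // !mulr1.
  have := congr1 (fun f : {fps K} => f 0%N) c_inv.
  rewrite coef_fpsM coef_fps1 big_ord1 /=.
  have -> : ((0 - 0).+1 - m = 0)%N by lia.
  by rewrite mulr1.
apply: big1 => w _; have := @sum_run_prefixes w.
by rewrite size_tuple => /(_ isT).
Qed.

End RunTheorem.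

(** * Standardization *)

Section ChainCount.

Definition chain_step (p q : bool * nat) : bool := (p.2 + q.1 <= q.2)%N.

(* Letters are at least [lo]; [true] at position i makes the i-th step strict. *)
Definition chain (lo : nat) (ds : seq bool) (a : seq nat) : bool :=
  path chain_step (false, lo) (zip ds a).

(** The hockey-stick identity. The bound d <= n keeps the subtraction exact at every step of the
    induction. *)
Lemma sum_bin_diag n d k : (d <= n)%N ->
  (\sum_(i < k) 'C(n + i - d, n) = 'C(n + k - d, n.+1))%N.
Proof.
move=> dn; elim: k => [|k IHk].
  by rewrite big_ord0 bin_small //; lia.
rewrite big_ord_recr /= IHk.
have -> : (n + k.+1 - d = (n + k - d).+1)%N by lia.
by rewrite binS.
Qed.

(** Lowering each letter by [lo] and by the number of strict steps up to it leaves a weakly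
    increasing word over k - lo - c letters, c being the number of strict steps. The induction
    removes the first letter, which becomes the lower bound for the rest. *)
Lemma chain_count k n lo (ds : seq bool) : size ds = n ->
  (\sum_(a : n.-tuple 'I_k) chain lo ds (map val a) =
   'C(n + k - (lo + 1 + count id ds), n))%N.
Proof.
move=> <-{n}; elim: ds lo => [|d ds IHds] lo.
  by rewrite (big_tuple0 (fun a => chain lo [::] (map val a) : nat)) bin0.
rewrite (big_tuple_cons _ (fun a => chain lo (d :: ds) (map val a) : nat)) /=.
set N := size ds; set c := count id ds; set j := (lo + d)%N.
have c_le : (c <= N)%N by exact: count_size.
transitivity (\sum_(x < k) (j <= x) * 'C(N + k - (x + 1 + c), N))%N.
  apply: eq_bigr => x _; rewrite -IHds big_distrr; apply: eq_bigr => w _ /=.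
  by rewrite mulnb /chain /=; case: (zip ds _).
(* Reversing the alphabet turns the lower bound on the first letter into an upper bound, as the
   hockey-stick sum needs. *)
rewrite (reindex_inj rev_ord_inj) /=.
transitivity (\sum_(x < k | (x < k - j)%N) 'C(N + x - c, N))%N.
  rewrite [RHS]big_mkcond; apply: eq_bigr => x _; have xk := ltn_ord x.
  have -> : (j <= k - x.+1)%N = (x < k - j)%N by lia.
  have -> : (N + k - (k - x.+1 + 1 + c) = N + x - c)%N by lia.
  by case: ifP => _; rewrite ?mul1n ?mul0n.
rewrite -(big_ord_widen _ (fun x => 'C(N + x - c, N))) ?leq_subr //.
rewrite sum_bin_diag //; have [jk|kj] := leqP j k.
  by congr 'C(_, _); rewrite /j in jk *; lia.
by rewrite !bin_small //; rewrite /j in kj *; lia.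
Qed.

Lemma chain0P (ds : seq bool) (a : seq nat) :
  size ds = size a -> nth false ds 0 = false ->
  reflect (forall i, (i.+1 < size a)%N ->
             (nth 0%N a i + nth false ds i.+1 <= nth 0%N a i.+1)%N)
          (chain 0 ds a).
Proof.
move=> Esize ds0; apply: (iffP (pathP (false, 0%N))) => H i; last first.
  rewrite size_zip Esize minnn; case: i => [|i] ia.
    by rewrite nth_zip //= /chain_step /= ds0.
  by rewrite [nth _ (_ :: _) _]/= !nth_zip // /chain_step /= H.
move=> ia; have := H i.+1; rewrite size_zip Esize minnn => /(_ ia).
by rewrite [nth _ (_ :: _) _]/= !nth_zip.
Qed.

End ChainCount.

(** * The permutation that ranks the values of an injection *)

Section RankPermutation.
Variables (n : nat) (f : 'I_n -> nat).
Hypothesis f_inj : injective f.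

Lemma card_smaller_lt i : (#|[set j | f j < f i]| < n)%N.
Proof.
have: [set j | f j < f i]%N \proper [set: 'I_n].
  by apply/properP; split; [exact: subsetT | exists i; rewrite ?inE ?ltnn].
by move/proper_card; rewrite cardsT card_ord.
Qed.

Definition rank i : 'I_n := Ordinal (card_smaller_lt i).

Lemma ltn_rank i j : (rank i < rank j)%N = (f i < f j)%N.
Proof.
case: (ltnP (f i) (f j)) => fij.
  apply: proper_card; apply/properP; split.
    by apply/subsetP => l; rewrite !inE => /ltn_trans; apply.
  by exists i; rewrite ?inE ?ltnn.
rewrite ltnNge; apply/negbF; apply: subset_leq_card.
by apply/subsetP => l; rewrite !inE => /leq_trans; apply.
Qed.

Lemma rank_inj : injective rank.
Proof.
move=> i j rij; apply: f_inj; apply/eqP; rewrite eqn_leq.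
by rewrite leqNgt -ltn_rank rij ltnn leqNgt -ltn_rank rij ltnn.
Qed.

Definition rank_perm : 'S_n := perm rank_inj.

Lemma card_ltn_ord i : (i <= n)%N -> #|[set j : 'I_n | (j < i)%N]| = i.
Proof.
move=> le_in; have inj : injective (widen_ord le_in).
  by move=> a b /(congr1 val) /= /val_inj.
rewrite -[RHS](card_ord i) -(card_imset _ inj).
apply: eq_card => j; rewrite inE; apply/idP/imsetP => [ji|[l _ ->]] //=.
by exists (Ordinal ji) => //; apply: val_inj.
Qed.

(** Each pi i is the number of values of pi below it, so the comparisons among these values
    determine pi. *)
Lemma rank_permP (pi : 'S_n) :
  reflect (forall i j, (pi i < pi j)%N = (f i < f j)%N) (rank_perm == pi).
Proof.
apply: (iffP eqP) => [<- i j|fpi]; first by rewrite !permE ltn_rank.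
apply/permP => i; rewrite permE; apply: val_inj => /=.
rewrite -[RHS](card_ltn_ord (ltnW (ltn_ord (pi i)))) -(card_imset _ (@perm_inj _ pi)).
apply: eq_card => j; rewrite inE; apply/imsetP/idP => [[l + ->]|].
  by rewrite inE -fpi.
by move=> ji; exists ((pi^-1)%g j); rewrite ?inE -?fpi ?permKV.
Qed.

End RankPermutation.

Lemma facocc_map (T1 T2 : Type) (h : T1 -> T2) (r : rel T2) m (w : seq T1) :
  facocc r m (map h w) = facocc (relpre h r) m w.
Proof.
rewrite /facocc size_map; apply: eq_count => i.
by rewrite -map_drop -map_take sorted_map.
Qed.

Lemma std_sorted (u : seq nat) : sorted ltn u -> std u = iota 1 (size u).
Proof.
elim: u => // x u IHu xu; have ux := order_path_min ltn_trans xu.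
rewrite /std /= leqnn; congr (_ :: _).
  rewrite (@eq_in_count _ _ pred0) ?count_pred0 // => y yu /=.
  by apply/negbTE; rewrite -ltnNge (allP ux).
rewrite (iotaDl 1 1) -IHu ?(path_sorted xu) // -map_comp.
by apply/eq_in_map => y yu /=; rewrite (ltnW (allP ux _ yu)).
Qed.

(** If u_(i+1) <= u_i, every letter at most u_(i+1) is at most u_i, so the entries of [std u] could
    not increase from position i to i+1. *)
Lemma std_eq_iota (u : seq nat) : (std u == iota 1 (size u)) = sorted ltn u.
Proof.
apply/eqP/idP => [stdE|]; last exact: std_sorted.
apply/(sortedP 0%N) => i iu; rewrite /= ltnNge; apply/negP => ui.
have := sub_count (fun b (h : b <= nth 0%N u i.+1) => leq_trans h ui)%N u.
have nthE j : (j < size u)%N ->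
    count (fun b => b <= nth 0%N u j)%N u = j.+1.
  move=> ju; have := congr1 (fun v => nth 0%N v j) stdE.
  by rewrite nth_iota // (nth_map 0%N).
by rewrite !nthE ?ltnn // ltnW.
Qed.

Lemma oneline_incr_perm m : oneline (incr_perm m) = iota 1 m.
Proof.
rewrite /oneline (eq_map (fun i => congr1 (fun j : 'I_m => j.+1) (perm1 i))).
by rewrite (map_comp S val) val_enum_ord -(iotaDl 1 0).
Qed.

Lemma nth_oneline n (pi : 'S_n) (i : 'I_n) : nth 0%N (oneline pi) i = (pi i).+1.
Proof. by rewrite (nth_map i) ?size_enum_ord // nth_ord_enum. Qed.

Lemma nth_oneline_inord n (pi : 'S_n.+1) i : (i < n.+1)%N ->
  nth 0%N (oneline pi) i = (pi (inord i)).+1.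
Proof. by move=> lt_in; rewrite -nth_oneline inordK. Qed.

Lemma size_oneline n (pi : 'S_n) : size (oneline pi) = n.
Proof. by rewrite size_map size_enum_ord. Qed.

Lemma occ_incr_perm m n (pi : 'S_n) :
  occ (incr_perm m) pi = facocc ltn m (oneline pi).
Proof.
rewrite /occ /facocc size_oneline; apply: eq_in_count => i.
rewrite mem_iota add0n => ilt; rewrite oneline_incr_perm -std_eq_iota.
by rewrite size_takel // size_drop size_oneline; lia.
Qed.

(** Sortedness of a window depends only on its adjacent comparisons, so words over different types
    can be compared. *)
Lemma facocc_congr (T1 T2 : Type) (x1 : T1) (x2 : T2) (r1 : rel T1)
    (r2 : rel T2) m (w1 : seq T1) (w2 : seq T2) : size w1 = size w2 ->
  (forall i, (i.+1 < size w1)%N ->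
     r1 (nth x1 w1 i) (nth x1 w1 i.+1) = r2 (nth x2 w2 i) (nth x2 w2 i.+1)) ->
  facocc r1 m w1 = facocc r2 m w2.
Proof.
move=> Esize rE; rewrite /facocc Esize; apply: eq_in_count => i _.
have sizeE : size (take m (drop i w1)) = size (take m (drop i w2)).
  by rewrite !size_take_min !size_drop Esize.
have nthE j : (j.+1 < size (take m (drop i w1)))%N ->
    r1 (nth x1 (take m (drop i w1)) j) (nth x1 (take m (drop i w1)) j.+1) =
    r2 (nth x2 (take m (drop i w2)) j) (nth x2 (take m (drop i w2)) j.+1).
  rewrite size_take_min size_drop leq_min => /andP[jm jw].
  rewrite !nth_take ?(ltnW jm) // !nth_drop addnS rE //; lia.
apply/(sortedP x1)/(sortedP x2) => H j.
  by rewrite -sizeE => jw; rewrite -nthE ?H.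
by move=> jw; rewrite nthE // H -?sizeE.
Qed.

Section Standardization.
Variables (n k : nat).
Implicit Type w : n.-tuple 'I_k.

(* The lexicographic order on the pairs (w_i, i), encoded in one number. *)
Definition word_key w (i : 'I_n) : nat := (tnth w i * n + i)%N.

(** Positions are below n, so letters decide first and positions break ties; the inequality between
    letters must be strict exactly when j < i. *)
Lemma ltn_word_key w (i j : 'I_n) : i != j ->
  (word_key w i < word_key w j)%N = (tnth w i + (j < i) <= tnth w j)%N.
Proof.
rewrite -val_eqE /word_key /= => nij; have [iN jN] := (ltn_ord i, ltn_ord j).
move: (tnth w i : nat) (tnth w j : nat) => a b.
case: (ltngtP a b) => [ab|ba|->]; last first.
- rewrite ltn_add2l; case: (ltngtP i j) nij => //= _ _; lia.
- have := leq_mul2r n b.+1 a; rewrite ba orbT mulSn => h; lia.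
- have := leq_mul2r n a.+1 b; rewrite ab orbT mulSn => h; lia.
Qed.

Lemma word_key_inj w : injective (word_key w).
Proof.
move=> i j keyE; apply/eqP; apply: contraT => nij.
have := ltn_word_key w nij; rewrite eq_sym in nij.
have := ltn_word_key w nij; rewrite keyE ltnn.
have: i != j :> nat by rewrite eq_sym.
by case: ltngtP => //; lia.
Qed.

Definition std_perm w : 'S_n := rank_perm (@word_key_inj w).

End Standardization.

(* A leading [false], because the first letter of a chain is not constrained. *)
Definition des_bits n (p : 'S_n) : seq bool :=
  false :: [seq (nth 0 (oneline p) i > nth 0 (oneline p) i.+1)%N
             | i <- iota 0 n.-1].

(** The word standardizes to pi exactly when its keys increase along pi^-1(0), pi^-1(1), and so on.
    By [ltn_word_key], each step of the letters read in this order is weak, and strict at the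
    descents of pi^-1. *)
Lemma std_permE n k (w : n.+1.-tuple 'I_k) (pi : 'S_n.+1) :
  (std_perm w == pi) =
  chain 0 (des_bits pi^-1)
    (map val [tuple tnth w ((pi^-1)%g i) | i < n.+1]).
Proof.
set p := (pi^-1)%g; set a := map _ _.
have sz : size a = n.+1 by rewrite size_map size_tuple.
have na i : (i < n.+1)%N -> nth 0%N a i = tnth w (p (inord i)).
  move=> lt_in; rewrite (nth_map (tnth w (inord i))) ?size_tuple //.
  by rewrite -[X in nth _ _ X](inordK lt_in) -tnth_nth tnth_mktuple.
have nb i : (i < n)%N ->
    nth false (des_bits p) i.+1 = (p (inord i) > p (inord i.+1))%N.
  move=> lt_in /=; rewrite (nth_map 0%N) ?size_iota // nth_iota // add0n.
  by rewrite !nth_oneline_inord // ltnW.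
have sd : size (des_bits p) = size a by rewrite /= size_map size_iota sz.
have adj i : (i < n)%N ->
    (nth 0 a i + nth false (des_bits p) i.+1 <= nth 0 a i.+1)%N =
    (word_key w (p (inord i)) < word_key w (p (inord i.+1)))%N.
  move=> lt_in; rewrite nb // ltn_word_key.
    by rewrite !na // ltnW.
  by rewrite (inj_eq perm_inj) -val_eqE /= !inordK; lia.
apply/rank_permP/(chain0P sd (erefl _)) => [H i|H].
  rewrite sz ltnS => lt_in; rewrite adj // -H !permKV !inordK //; lia.
(* Increases at adjacent positions extend to all pairs by transitivity. *)
have homo (i j : 'I_n.+1) : (i < j)%N -> (word_key w (p i) < word_key w (p j))%N.
  move=> ij; rewrite -(inord_val i) -(inord_val j).
  apply: (@homo_ltn_in _ [pred l | l < n.+1]%N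
    (fun l => word_key w (p (inord l))) (fun x y => (x < y)%N)) => //=.
  - by move=> y x z; apply: ltn_trans.
  - by move=> x y _ yn z /andP[_ /ltn_trans]; apply.
  - by move=> l _ ln; rewrite -adj // H // sz.
  - by rewrite inE.
  - by rewrite inE.
move=> i j; rewrite -[i in RHS](permK pi) -[j in RHS](permK pi) -/p.
case: (ltngtP (pi i) (pi j)) => [/homo ->//|/homo h|/val_inj->]; last by rewrite ltnn.
by rewrite ltnNge ltnW.
Qed.

(** Permuting the positions by pi is a bijection on words, after which [chain_count] applies with
    ides(pi) strict steps. *)
Lemma sum_std_perm n k (pi : 'S_n.+1) :
  (\sum_(w : n.+1.-tuple 'I_k) (std_perm w == pi) =
   'C(n + k - ides pi, n.+1))%N.
Proof.
pose act (p : 'S_n.+1) (w : n.+1.-tuple 'I_k) := [tuple tnth w (p i) | i < n.+1].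
have actK (p : 'S_n.+1) : cancel (act p) (act p^-1)%g.
  by move=> w; apply: eq_from_tnth => i; rewrite !tnth_mktuple permKV.
have actKV (p : 'S_n.+1) : cancel (act p^-1)%g (act p).
  by move=> w; apply: eq_from_tnth => i; rewrite !tnth_mktuple permK.
rewrite (reindex (act pi)); last first.
  by exists (act pi^-1)%g => w _; [exact: actK | exact: actKV].
under eq_bigr => w _ do rewrite std_permE -/(act _ _) actK.
rewrite chain_count; last by rewrite /= size_map size_iota.
by rewrite /ides /des /= count_map add0n; congr 'C(_, _).
Qed.

(** Between adjacent positions ties are broken from left to right, so a strict ascent of the
    standardization is a weak ascent of the word. *)
Lemma occ_std_perm m n k (w : n.+1.-tuple 'I_k) :
  occ (incr_perm m) (std_perm w) = facocc (relpre val leq) m w.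
Proof.
rewrite occ_incr_perm -facocc_map; apply: (@facocc_congr _ _ 0%N 0%N).
  by rewrite size_oneline size_map size_tuple.
move=> i; rewrite size_oneline ltnS => lt_in.
have i1 : (i < n.+1)%N by lia.
have wE (j : 'I_n.+1) : nth 0%N (map val w) j = tnth w j.
  by rewrite (nth_map (tnth w j)) ?size_tuple // -tnth_nth.
rewrite (nth_oneline _ (Ordinal i1)) (nth_oneline _ (Ordinal (lt_in : i.+1 < n.+1)%N)).
rewrite (wE (Ordinal i1)) (wE (Ordinal (lt_in : i.+1 < n.+1)%N)) /= ltnS.
have /rank_permP -> := eqxx (std_perm w); rewrite ltn_word_key.
  by rewrite /= ltnNge leqnSn addn0.
by rewrite -val_eqE /=; lia.
Qed.

Lemma sum_words (K : comNzRingType) (s : K) m n k :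
  \sum_(w : n.+1.-tuple 'I_k) s ^+ facocc (relpre val leq) m w =
  \sum_(pi : 'S_n.+1) s ^+ occ (incr_perm m) pi * 'C(n + k - ides pi, n.+1)%:R.
Proof.
rewrite (partition_big (@std_perm n.+1 k) predT) //=; apply: eq_bigr => pi _.
rewrite -sum_std_perm natr_sum mulr_sumr big_mkcond; apply: eq_bigr => w _.
by case: eqP => [<-|]; rewrite ?mulr1 ?mulr0 // occ_std_perm.
Qed.

Lemma sum_sorted_words (K : comNzRingType) n k :
  \sum_(w : n.-tuple 'I_k) (sorted (relpre val leq) w)%:R =
  'C(n + k - 1, n)%:R :> K.
Proof.
rewrite -natr_sum; congr _%:R.
have := @chain_count k n 0 (nseq n false) (size_nseq _ _).
rewrite (_ : count id _ = 0)%N; last by rewrite count_nseq.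
move <-; apply: eq_bigr => w _; congr nat_of_bool.
rewrite -sorted_map.
apply/(sortedP 0%N)/chain0P; rewrite ?size_nseq ?size_map ?size_tuple //.
- by case: n w.
- by move=> H i /H; rewrite nth_nseq if_same addn0.
- by move=> H i /H; rewrite nth_nseq if_same addn0.
Qed.

(** * The generating functions *)

Lemma mulr_1B_geom (R : comNzRingType) (m : nat) (u : R) : (0 < m)%N ->
  (1 - u) * (1 + \sum_(1 <= l < m) u ^+ l) = 1 - u ^+ m.
Proof.
case: m => // m _; rewrite -(expr0 u) -big_ltn // big_mkord expr0.
by rewrite -opprB mulNr -subrX1 opprB.
Qed.

(** The inner denominator in (a); it equals 1 - s u times the series of run weights, by
    [run_denomE]. *)
Definition run_denom (R : comNzRingType) (m : nat) (a u : R) : R :=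
  1 - (a - 1) * \sum_(1 <= l < m) u ^+ l.

Lemma rmorph_run_denom (R R' : comNzRingType) (g : {rmorphism R -> R'}) m a u :
  g (run_denom m a u) = run_denom m (g a) (g u).
Proof.
rewrite rmorphB rmorphM rmorphB rmorph1 rmorph_sum.
by congr (_ - _ * _); apply: eq_bigr => l _; rewrite rmorphXn.
Qed.

Section RunSeries.
Variables (K : comUnitRingType) (s : K) (m : nat).
Hypothesis m_ge2 : (2 <= m)%N.

(* The inverse c of the series of run weights, see [run_inv_weights]. *)
Definition run_inv : {fps K} :=
  (1 - fpsC s * fpsX) / run_denom m (fpsC s) fpsX.

(** The weights are 1 below degree m, so their difference with s times the previous one is 1 - s in
    degrees 1 to m - 1; from degree m on they grow by the factor s and cancel. *)
Lemma run_denomE :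
  run_denom m (fpsC s) fpsX =
  (1 - fpsC s * fpsX) * Fps (fun n => s ^+ (n.+1 - m)).
Proof.
apply: fpsP => n; rewrite mulrBl mul1r -mulrA /run_denom.
have -> : fpsC s - 1 = fpsC (s - 1) by rewrite rmorphB rmorph1.
rewrite !coef_fpsB !coef_fpsCM.
rewrite coef_fpsXM coef_fps1 coef_fps_sum.
under eq_bigr do rewrite coef_fpsXn.
case: n => [|n] /=.
  rewrite big_nat big1 => [|i /andP[i0 _]]; last by case: i i0.
  have -> : (1 - m = 0)%N by lia.
  by rewrite !mulr0.
have -> : \sum_(1 <= l < m) (n.+1 == l)%:R = (n.+1 < m)%:R :> K.
  have [nm|mn] := ltnP n.+1 m.
    rewrite (bigD1_seq n.+1) ?mem_index_iota ?iota_uniq //= eqxx big1 ?addr0 //.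
    by move=> i; rewrite eq_sym => /negPf->.
  rewrite big_nat big1 // => i /andP[_ im].
  by rewrite gtn_eqF // (leq_trans im).
have [nm|mn] := ltnP n.+1 m; rewrite sub0r.
  have [-> ->] : (n.+2 - m = 0)%N /\ (n.+1 - m = 0)%N by lia.
  by rewrite !mulr1 opprB.
have -> : (n.+2 - m = (n.+1 - m).+1)%N by lia.
by rewrite mulr0 oppr0 exprS subrr.
Qed.

Lemma run_denom_unit : run_denom m (fpsC s) (fpsX : {fps K}) \is a GRing.unit.
Proof.
rewrite fps_unitE run_denomE coef_fpsM big_ord1 coef_fpsB coef_fps1.
rewrite coef_fpsCM mulr0 subr0 mul1r /=.
have -> : (1 - m = 0)%N by lia.
by rewrite unitr1.
Qed.

Lemma run_inv_denom : run_inv * run_denom m (fpsC s) fpsX = 1 - fpsC s * fpsX.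
Proof. by rewrite /run_inv mulrVK // run_denom_unit. Qed.

Lemma run_inv_weights : run_inv * Fps (fun n => s ^+ (n.+1 - m)) = 1.
Proof.
have u : 1 - fpsC s * fpsX \is a GRing.unit.
  by apply: fps_unit_1B; rewrite coef_fpsCM mulr0.
by apply: (mulrI u); rewrite mulrCA -run_denomE run_inv_denom mulr1.
Qed.

Lemma coef0_run_inv : run_inv 0%N = 1.
Proof.
have := congr1 (fun f : {fps K} => f 0%N) run_inv_weights.
rewrite coef_fpsM coef_fps1 big_ord1 /=.
have -> : ((0 - 0).+1 - m = 0)%N by lia.
by rewrite mulr1.
Qed.

Lemma substz_run_inv :
  substz run_inv * run_denom m (fpsC (fpsC s)) (zvar K) =
  1 - fpsC (fpsC s) * zvar K.
Proof.
rewrite -substzX -substzC -rmorph_run_denom -rmorphM run_inv_denom.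
by rewrite rmorphB rmorph1 rmorphM.
Qed.

Definition words_series (k : nat) : {fps K} :=
  Fps (fun n => \sum_(w : n.-tuple 'I_k) s ^+ facocc (relpre val leq) m w).

Definition sorted_series (k : nat) : {fps K} :=
  Fps (fun n => run_inv n * 'C(n + k - 1, n)%:R).

Lemma sorted_words_series k : sorted_series k * words_series k = 1.
Proof.
rewrite -(run_theorem (T := 'I_k) (relpre val leq) m_ge2 run_inv_weights).
by congr (_ * _); apply: fpsP => n; rewrite [RHS]/= sum_sorted_words.
Qed.

Lemma words_seriesE k : words_series k = (sorted_series k)^-1.
Proof. by have /mulr1_eq := sorted_words_series k. Qed.

(** For k = 0 both sides are 1: t/(1-t) has no constant term, and C(n-1, n) = 0 for n > 0. For k > 0
    the 1 in 1 - c(z) only cancels the term of degree 0. *)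
Lemma coef_sorted_series k :
  1 - (tvar K / (1 - tvar K) * (1 - substz run_inv)) k = sorted_series k.
Proof.
apply: fpsP => n; rewrite -{2}(rmorph1 (@substz K)) mulrBr.
rewrite !coef_fpsB !coef_tvarM_substz !coef_fps1.
rewrite -[RHS]/(run_inv n * 'C(n + k - 1, n)%:R); case: k => [|k].
  rewrite subrr subr0; case: n => [|n]; first by rewrite coef0_run_inv mulr1.
  by rewrite bin_small ?mulr0 // addn0 subn1.
have -> : (n + k.+1 - 1 = n + k)%N by lia.
rewrite opprB addrCA; case: n => [|n]; last by rewrite mul0r subr0 addr0.
by rewrite eqxx bin0 !mulr1 subrr addr0.
Qed.

Lemma coef0_sorted_series k : sorted_series k 0%N = 1.
Proof. by rewrite -[LHS]/(run_inv 0%N * 'C(_, 0)%:R) coef0_run_inv bin0 mulr1. Qed.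

(** The t^k coefficient of t^(ides(pi)+1)/(1-t)^(n+1) is the number of words standardizing to pi;
    both vanish when k <= ides(pi) and n > 0. *)
Lemma A_ides_coef n :
  A_ides (incr_perm m) n (fpsC (fpsC s)) (tvar K) / (1 - tvar K) ^+ n.+1 =
  Fps (fun k => fpsC (words_series k n)).
Proof.
apply: fpsP => k; case: n => [|n]; rewrite [RHS]/=.
  rewrite (_ : A_ides _ _ _ _ = 1) // mul1r coef_fps_expV1BX bin0.
  rewrite (big_tuple0 (fun w : seq 'I_k => s ^+ facocc (relpre val leq) m w)).
  by rewrite facocc_nil // rmorph1.
rewrite (_ : A_ides _ _ _ _ = \sum_(pi : 'S_n.+1)
  fpsC (fpsC s) ^+ occ (incr_perm m) pi * tvar K ^+ (ides pi).+1) //.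
rewrite sum_words rmorph_sum mulr_suml coef_fps_sum; apply: eq_bigr => pi _.
rewrite -mulrA -!rmorphXn coef_fpsCM rmorphM rmorph_nat; congr (_ * _).
rewrite coef_fpsXnM coef_fps_expV1BX; case: leqP => [le|lt].
  by rewrite bin_small //; lia.
by congr ('C(_, _)%:R); lia.
Qed.

Lemma A_ides_has_sum :
  fps2_has_sum
    (fun n => A_ides (incr_perm m) n (fpsC (fpsC s)) (tvar K) /
                (1 - tvar K) ^+ n.+1 * xvar K ^+ n)
    (Fps words_series).
Proof.
(* The n-th term carries only x^n, so the coefficient of x^j is settled after j + 1 terms. *)
move=> i j; exists j.+1 => N jN; rewrite !coef_fps_sum.
have coefE (n : 'I_N) :
    (A_ides (incr_perm m) n (fpsC (fpsC s)) (tvar K) /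
       (1 - tvar K) ^+ n.+1 * xvar K ^+ n) i j =
    (if n == Ordinal jN then words_series i j else 0).
  rewrite A_ides_coef -rmorphXn mulrC coef_fpsCM mulrC coef_fpsCM coef_fpsXn.
  rewrite -val_eqE eq_sym; case: eqP => [->|_]; first by rewrite mulr1.
  by rewrite mulr0.
by under eq_bigr do rewrite coefE; rewrite -big_mkcond big_pred1_eq.
Qed.

(** The iteration starts at 1/(1-t), whose coefficients are all 1. *)
Lemma hadamard_powE (R : comUnitRingType) (f : {fps R}) n k :
  hadamard_pow f n k = f k ^+ n.
Proof.
elim: n => [|n IHn]; last by rewrite exprS -IHn.
by have := coef_fps_expV1BX R 0 k; rewrite expr1 bin0 expr0.
Qed.

(** At each t^k this is a geometric series in an element of K[[x]] without constant term. *)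
Lemma hadamard_has_sum :
  fps2_has_sum
    (hadamard_pow (tvar K / (1 - tvar K) * (1 - substz run_inv)))
    (Fps words_series).
Proof.
set f := tvar K / _ * _.
have f0 k : f k 0%N = 0.
  apply: (subrI 1); rewrite subr0 -[LHS]/((1 - f k) 0%N).
  by rewrite coef_sorted_series coef0_sorted_series.
move=> i j; exists j.+1 => N jN; rewrite coef_fps_sum.
under eq_bigr do rewrite hadamard_powE.
by rewrite coef_fps_geom // coef_sorted_series -words_seriesE.
Qed.

End RunSeries.

Lemma zvar_unit (K : comUnitRingType) m : (0 < m)%N ->
  1 - zvar K ^+ m \is a GRing.unit.
Proof.
move=> m_gt0; rewrite -substzX -rmorphXn -(rmorph1 (@substz K)) -rmorphB.
apply/rmorph_unit/fps_unit_1B.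
by rewrite coef_fpsXn; case: m m_gt0.
Qed.

Lemma summand_aE (K : comUnitRingType) (s : K) m : (2 <= m)%N ->
  let t := tvar K in let x := xvar K in let z := zvar K in
  let s' := fpsC (fpsC s) in
  t * x / (1 - t) ^+ 2 +
    (s' - 1) * t * z ^+ m / ((1 - t) * run_denom m s' z) =
  t / (1 - t) * (1 - substz (run_inv s m)).
Proof.
move=> m_ge2 t x z s'.
have ut : 1 - t \is a GRing.unit by exact: tvar_unit.
have uQ : run_denom m s' z \is a GRing.unit.
  rewrite /z /s' -substzX -substzC -rmorph_run_denom.
  exact/rmorph_unit/run_denom_unit.
suff E : z + (s' - 1) * z ^+ m / run_denom m s' z = 1 - substz (run_inv s m).
  rewrite -E expr2 !invrM //; move: (run_denom m s' z)^-1 => q.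
  rewrite (_ : z = x / (1 - t)) //; ring.
apply: (mulIr uQ); rewrite mulrDl mulrVK // [RHS]mulrBl mul1r substz_run_inv //.
(* With z^m written through the geometric sum, the claim is a polynomial identity in s, z and that
   sum. *)
have -> : z ^+ m = 1 - (1 - z) * (1 + \sum_(1 <= l < m) z ^+ l).
  by rewrite mulr_1B_geom ?(ltnW m_ge2) // subKr.
by rewrite /run_denom -/z -/s'; ring.
Qed.

Lemma summand_bE (K : comUnitRingType) m : (2 <= m)%N ->
  let t := tvar K in let z := zvar K in
  t * z * (1 - z ^+ m.-1) / ((1 - t) * (1 - z ^+ m)) =
  t / (1 - t) * (1 - substz (run_inv 0 m)).
Proof.
move=> m_ge2 t z; have m_gt0 := ltnW m_ge2.
have ut : 1 - t \is a GRing.unit by exact: tvar_unit.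
have uz : 1 - z ^+ m \is a GRing.unit by exact: zvar_unit.
suff E : z * (1 - z ^+ m.-1) / (1 - z ^+ m) = 1 - substz (run_inv 0 m).
  by rewrite -E invrM //; ring.
apply: (mulIr uz); rewrite mulrVK // [RHS]mulrBl mul1r.
have := substz_run_inv (0 : K) m_ge2.
rewrite !rmorph0 mul0r subr0 /run_denom sub0r mulN1r opprK => E.
rewrite -[in RHS](mulr_1B_geom z m_gt0) (mulrCA (substz _)) E mulr1.
by rewrite mulr_1B_geom // mulrBr mulr1 -exprS prednK //; ring.
Qed.

(** * The case s = 0 and explicit binomial coefficients *)

Section SpecialCase.
Variables (K : comUnitRingType) (m : nat).
Hypothesis m_ge2 : (2 <= m)%N.

Lemma sum_multiples (N n : nat) (a : nat -> K) : (n < N)%N ->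
  \sum_(j < N) a (j * m)%N * (n == (j * m)%N)%:R = a n * (m %| n)%:R.
Proof.
move=> nN; have [/dvdnP[q nq]|mn] := boolP (m %| n)%N.
  have qN : (q < N)%N by apply: leq_ltn_trans nN; rewrite nq leq_pmulr // ltnW.
  rewrite (bigD1 (Ordinal qN)) //= -nq eqxx big1 ?addr0 // => j.
  rewrite -val_eqE /= nq eqn_pmul2r ?(ltnW m_ge2) // eq_sym => /negPf->.
  by rewrite mulr0.
rewrite mulr0 big1 // => j _; case: eqP => [nj|]; last by rewrite mulr0.
by rewrite nj dvdn_mull in mn.
Qed.

Lemma run_inv_s0 :
  run_inv (0 : K) m = (1 - fpsX) * Fps (fun n => (m %| n)%:R).
Proof.
have m_gt0 := ltnW m_ge2.
set D := Fps _; have DE : (1 - fpsX ^+ m) * D = 1.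
  apply: fpsP => n; rewrite mulrBl mul1r coef_fpsB coef_fpsXnM coef_fps1 /=.
  have [mn|nm] := leqP m n.
    rewrite -{1}(subnK mn) dvdn_addl ?dvdnn // subrr.
    by case: n mn => //; rewrite leqn0 -[m]prednK.
  rewrite subr0; congr _%:R; case: n nm => [|n] nm; first by rewrite dvdn0.
  by rewrite gtnNdvd.
rewrite -[LHS]mulr1 -[X in _ * X = _]DE -mulr_1B_geom //.
have := run_inv_denom (0 : K) m_ge2.
rewrite !rmorph0 mul0r subr0 /run_denom sub0r mulN1r opprK => E.
by rewrite mulrA mulrCA E mulr1.
Qed.

(** By [run_inv_s0], c has coefficient 1 at the degrees jm, -1 at jm + 1 and 0 elsewhere; C(i+k-1,
    i) = C(k+i-1, k-1) gives the two binomials. *)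
Lemma sorted_series_s0_has_sum k : (1 <= k)%N ->
  fps_has_sum
    (fun j => 'C(k + j * m - 1, k - 1)%:R * fpsX ^+ (j * m)
              - 'C(k + j * m, k - 1)%:R * fpsX ^+ (j * m + 1))
    (sorted_series (0 : K) m k).
Proof.
move=> k_gt0 i; exists i.+1 => N iN; rewrite coef_fps_sum.
have natM n (f : {fps K}) l : (n%:R * f) l = n%:R * f l.
  by rewrite -(rmorph_nat (@fpsC K)) coef_fpsCM.
under eq_bigr do rewrite coef_fpsB !natM !coef_fpsXn.
rewrite sumrB (sum_multiples (fun n => 'C(k + n - 1, k - 1)%:R) iN).
rewrite -[RHS]/(run_inv 0 m i * 'C(i + k - 1, i)%:R).
have binE : 'C(i + k - 1, i) = 'C(k + i - 1, k - 1).
  by rewrite addnC -[RHS]bin_sub; [congr 'C(_, _); lia | lia].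
rewrite run_inv_s0 binE mulrBl mul1r coef_fpsB coef_fpsXM mulrBl /= mulrC.
congr (_ - _); case: i iN binE => [|i] iN _.
  by rewrite mul0r big1 // => j _; rewrite addn1 mulr0.
under eq_bigr do rewrite addn1 eqSS.
rewrite (sum_multiples (fun n => 'C(k + n, k - 1)%:R) (ltnW iN)) mulrC.
by congr (_ * 'C(_, _)%:R); lia.
Qed.

(** Only the empty word exists over no letters; this is the leading 1 in (c). *)
Lemma words_series_no_letters (s : K) : words_series s m 0 = 1.
Proof.
apply: fpsP => -[|n]; rewrite coef_fps1 /=.
  rewrite (big_tuple0 (fun w : seq 'I_0 => s ^+ facocc (relpre val leq) m w)).
  by rewrite facocc_nil.
by rewrite big1 // => w; case: (thead w).
Qed.

Lemma words_series_has_sum (s : K) :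
  fps2_has_sum
    (fun k => fpsC ((sorted_series s m k.+1)^-1) * tvar K ^+ k.+1)
    (Fps (words_series s m) - 1).
Proof.
move=> i j; exists i => N iN; rewrite coef_fps_sum coef_fpsB.
under eq_bigr do rewrite coef_fpsCM coef_fpsXn.
rewrite coef_fps1; case: i iN => [|i] iN.
  rewrite big1 => [|k _]; last by rewrite mulr0.
  by rewrite eqxx -[Fps _ 0%N]/(words_series s m 0) words_series_no_letters subrr.
have termE (k : 'I_N) : (sorted_series s m k.+1)^-1 * (i.+1 == k.+1)%:R =
    if k == Ordinal iN then words_series s m i.+1 else 0.
  rewrite eqSS eq_sym -val_eqE; case: eqP => [->|_]; last by rewrite mulr0.
  by rewrite mulr1 -words_seriesE.
under eq_bigr do rewrite termE.
by rewrite -big_mkcond big_pred1_eq subr0.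
Qed.

End SpecialCase.

Theorem theorem4p3 (m : nat) (hm : (2 <= m)%N) :
  [/\ (* (a), in Q[[s]][[x]][[t]] *)
      let s := svar rat in
      let t := tvar {fps rat} in
      let x := xvar {fps rat} in
      let z := zvar {fps rat} in
      exists S,
        fps2_has_sum
          (fun n => A_ides (incr_perm m) n s t / (1 - t) ^+ n.+1 * x ^+ n) S /\
        fps2_has_sum
          (fun n => hadamard_pow
             (t * x / (1 - t) ^+ 2 +
              (s - 1) * t * z ^+ m /
                ((1 - t) * (1 - (s - 1) * \sum_(1 <= l < m) z ^+ l))) n) S,
      (* (b), in Q[[x]][[t]] *)
      let t := tvar rat in
      let x := xvar rat in
      let z := zvar rat in
      exists S,
        fps2_has_sum
          (fun n => A_ides (incr_perm m) n 0 t / (1 - t) ^+ n.+1 * x ^+ n) S /\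
        fps2_has_sum
          (fun n => hadamard_pow
             (t * z * (1 - z ^+ m.-1) / ((1 - t) * (1 - z ^+ m))) n) S
    & (* (c), in Q[[x]][[t]]; B k is the sum over j, a series in Q[[x]] *)
      let t := tvar rat in
      let x := xvar rat in
      exists (S T : {fps {fps rat}}) (B : nat -> {fps rat}),
        [/\ fps2_has_sum
              (fun n => A_ides (incr_perm m) n 0 t / (1 - t) ^+ n.+1 * x ^+ n) S,
            forall k, (1 <= k)%N ->
              fps_has_sum
                (fun j => 'C(k + j * m - 1, k - 1)%:R * fpsX ^+ (j * m)
                          - 'C(k + j * m, k - 1)%:R * fpsX ^+ (j * m + 1))
                (B k),
            fps2_has_sum (fun k => fpsC ((B k.+1)^-1) * t ^+ k.+1) T
          & S = 1 + T]].
Proof.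
have A0 := A_ides_has_sum (0 : rat) hm; rewrite !rmorph0 in A0.
split=> /=.
(* Here K is Q[[s]] and the weight is its variable. *)
- exists (Fps (words_series fpsX m)); split.
    exact: (A_ides_has_sum (fpsX : {fps rat}) hm).
  have := hadamard_has_sum (fpsX : {fps rat}) hm.
  by rewrite -summand_aE.
- exists (Fps (words_series 0 m)); split=> //.
  have := hadamard_has_sum (0 : rat) hm.
  by rewrite -summand_bE.
- exists (Fps (words_series 0 m)), (Fps (words_series 0 m) - 1).
  exists (sorted_series (0 : rat) m); split=> //.
  + by move=> k k_gt0; apply: sorted_series_s0_has_sum.
  + exact: words_series_has_sum.
  + by rewrite addrC subrK.
Qed.
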